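(* Let $n\ge3$. The Kostka-Foulkes polynomials $K^{C_n}_{\lambda,\mu}(q)$ for partitions $\lambda$ with $2\le|\lambda|\le3$ and $\mu$ with $|\mu|\le2$ are as follows (partitions are completed by zeros to length $n$; $\emptyset$ denotes the zero weight). $\lambda=(3)$: $K_{(3),(2)}=K_{(3),(1,1)}=K_{(3),\emptyset}=0$; $K_{(3),(1)}=q\,\frac{q^{2n}-1}{q^2-1}$. $\lambda=(2,1)$: $K_{(2,1),(2)}=K_{(2,1),(1,1)}=K_{(2,1),\emptyset}=0$; $K_{(2,1),(1)}=q\,\frac{q^{2n-2}-1}{q-1}$. $\lambda=(1,1,1)$: $K_{(1,1,1),(2)}=K_{(1,1,1),(1,1)}=K_{(1,1,1),\emptyset}=0$; $K_{(1,1,1),(1)}=q^2\,\frac{q^{2n-4}-1}{q^2-1}$. $\lambda=(2)$: $K_{(2),(2)}=1$; $K_{(2),(1,1)}=q$; $K_{(2),(1)}=0$; $K_{(2),\emptyset}=q\,\frac{q^{2n}-1}{q^2-1}$. $\lambda=(1,1)$: $K_{(1,1),(2)}=0$; $K_{(1,1),(1,1)}=1$; $K_{(1,1),(1)}=0$; $K_{(1,1),\emptyset}=q^2\,\frac{q^{2n-2}-1}{q^2-1}$.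
   Context: Write $\beta=(\beta_{\overline n},\dots,\beta_{\overline 1})$ for $\sum_i\beta_{\overline i}\varepsilon_{\overline i}$, $(\varepsilon_{\overline i})$ an orthonormal basis of $\mathbb R^n$; a partition $(\lambda_1\ge\lambda_2\ge\cdots)$ with at most $n$ parts is the dominant weight with $\lambda_{\overline n}=\lambda_1,\lambda_{\overline{n-1}}=\lambda_2,\dots$. For type $C_n$ ($sp_{2n}$) the positive roots are $\varepsilon_{\overline i}\pm\varepsilon_{\overline j}$ ($1\le j<i\le n$) and $2\varepsilon_{\overline i}$ ($1\le i\le n$), $\rho=(n,n-1,\dots,1)$, and $W$ is the group of signed permutations of the coordinates, with length $l$. The $q$-partition function is defined by $\prod_{\alpha\in R^+}\frac1{1-qx^\alpha}=\sum_\beta\mathcal P_q(\beta)x^\beta$ ($\mathcal P_q(\beta)=0$ if $\beta$ is not a nonnegative integral combination of positive roots), and $K_{\lambda,\mu}(q)=\sum_{\sigma\in W}(-1)^{l(\sigma)}\mathcal P_q(\sigma(\lambda+\rho)-(\mu+\rho))$. *)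

(* Defs.v *)
From mathcomp Require Import all_boot all_order all_fingroup all_algebra.
From mathcomp Require Import zify.

Set Implicit Arguments.
Unset Strict Implicit.
Unset Printing Implicit Defensive.

Import Order.TTheory GRing.Theory Num.Theory.
Local Open Scope ring_scope.

Notation "x %:F" := (tofrac x) : ring_scope.

(* Coordinate i : 'I_n of a weight is the one written beta_{\bar{n-i}}, so that
   reading a row from left to right gives (beta_{\bar n}, ..., beta_{\bar 1}).
   All the weights that occur have integer coordinates. *)
Definition weight (n : nat) := 'rV[int]_n.

Definition eps (n : nat) (i : 'I_n) : weight n := delta_mx 0 i.

Definition part_weight (n : nat) (s : seq nat) : weight n :=
  \row_i (nth 0%N s i)%:Z.

(* rho = (n, n-1, ..., 1) *)
Definition rho (n : nat) : weight n := \row_i (n - i)%N%:Z.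

Definition pos_roots (n : nat) : seq (weight n) :=
  [seq eps p.1 - eps p.2 | p : 'I_n * 'I_n <- enum {: 'I_n * 'I_n} & (p.1 < p.2)%N] ++
  [seq eps p.1 + eps p.2 | p : 'I_n * 'I_n <- enum {: 'I_n * 'I_n} & (p.1 < p.2)%N] ++
  [seq eps i *+ 2 | i <- enum 'I_n].

(* The finite type R^+. *)
Definition pos_root (n : nat) := seq_sub (pos_roots n).

(* The coefficient of q^k x^beta in
   \prod_(alpha in R^+) \sum_(m >= 0) (q x^alpha)^m :
   a choice of one term in each geometric series is a family (m alpha) of
   exponents, and those contributing to q^k are bounded by k. *)
Definition qpartition_coef (n : nat) (beta : weight n) (k : nat) : nat :=
  #|[set m : {ffun pos_root n -> 'I_k.+1} |
      ((\sum_a m a)%N == k) && (\sum_a val a *+ m a == beta)]|.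

Definition height (n : nat) (beta : weight n) : int :=
  \sum_(i < n) (n - i)%N%:Z * beta 0 i.

(* Every positive root has positive height, so P_q(beta) has degree at most
   height beta (see coef_qpartition below: the truncation loses nothing). *)
Definition qpartition (n : nat) (beta : weight n) : {poly int} :=
  \poly_(k < `|height beta|.+1) (qpartition_coef beta k)%:Z.

(* (p, s) stands for the map sending beta to the weight with i-th coordinate
   (-1)^(s i) * beta_(p i). *)
Definition sperm (n : nat) := ('S_n * {ffun 'I_n -> bool})%type.

Definition sperm_act (n : nat) (w : sperm n) (beta : weight n) : weight n :=
  \row_i ((-1) ^+ w.2 i * beta 0 (w.1 i)).

Definition sperm_id (n : nat) : sperm n := (1%g, [ffun=> false]).

(* Composition of the maps: first v, then u. *)
Definition sperm_mul (n : nat) (u v : sperm n) : sperm n :=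
  ((u.1 * v.1)%g, [ffun i => u.2 i (+) v.2 (u.1 i)]).

(* The reflections in the simple roots eps_i - eps_(i+1), and 2 eps_i when i
   is the last index. *)
Definition simple_refl (n : nat) (i : 'I_n) : sperm n :=
  if insub i.+1 is Some j then (tperm i j, [ffun=> false])
  else (1%g, [ffun k => k == i]).

Definition sperm_word (n : nat) (s : seq 'I_n) : sperm n :=
  foldr (fun i w => sperm_mul (simple_refl i) w) (sperm_id n) s.

Definition has_word (n : nat) (w : sperm n) (k : nat) : bool :=
  [exists s : k.-tuple 'I_n, sperm_word s == w].

Section Sperm.
Variable n : nat.
Implicit Types (u v w : sperm n) (i j : 'I_n) (beta : weight n).

Lemma sperm_act_id beta : sperm_act (sperm_id n) beta = beta.
Proof. by apply/rowP=> i; rewrite !mxE ffunE perm1 expr0 mul1r. Qed.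

Lemma sperm_act_mul u v beta :
  sperm_act (sperm_mul u v) beta = sperm_act u (sperm_act v beta).
Proof.
apply/rowP=> i; rewrite !mxE ffunE permM mulrA; congr (_ * _).
by rewrite signr_addb.
Qed.

Lemma sperm_mulA u v w :
  sperm_mul u (sperm_mul v w) = sperm_mul (sperm_mul u v) w.
Proof.
rewrite /sperm_mul /=; congr (_, _); first by rewrite mulgA.
by apply/ffunP=> i; rewrite !ffunE permM addbA.
Qed.

Lemma sperm_mul1 w : sperm_mul (sperm_id n) w = w.
Proof.
case: w => p s; rewrite /sperm_mul /= mul1g; congr (_, _).
by apply/ffunP=> i; rewrite !ffunE perm1.
Qed.

Lemma sperm_1mul w : sperm_mul w (sperm_id n) = w.
Proof.
case: w => p s; rewrite /sperm_mul /= mulg1; congr (_, _).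
by apply/ffunP=> i; rewrite !ffunE addbF.
Qed.

Let gen w := exists s : seq 'I_n, sperm_word s = w.

Let gen_id : gen (sperm_id n). Proof. by exists [::]. Qed.

Let gen_mul u v : gen u -> gen v -> gen (sperm_mul u v).
Proof.
move=> [s <-] [t <-]; exists (s ++ t).
by elim: s => /= [|i s ->]; rewrite ?sperm_mul1 ?sperm_mulA.
Qed.

Let gen_simple i : gen (simple_refl i).
Proof. by exists [:: i]; rewrite /= sperm_1mul. Qed.

Let pm (p : 'S_n) : sperm n := (p, [ffun=> false]).

Let pmM p r : sperm_mul (pm p) (pm r) = pm (p * r)%g.
Proof. by congr (_, _); apply/ffunP=> i; rewrite !ffunE. Qed.

Let gen_tperm i j : gen (pm (tperm i j)).
Proof.
wlog leij : i j / (i <= j)%N.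
  by move=> H; case: (leqP i j) => [/H//|/ltnW/H]; rewrite tpermC.
move: leij; move: {2}(val j) (erefl (val j)) => m.
elim: m j => [|m IH] j jm leij.
  have -> : i = j by apply/val_inj; move: jm leij => /= ->; lia.
  by rewrite tperm1; exact: gen_id.
have [eij|nij] := eqVneq i j; first by rewrite eij tperm1; exact: gen_id.
have ltij : (i < j)%N.
  by rewrite ltn_neqAle leij andbT; apply: contraNneq nij => /val_inj ->.
have mn : (m < n)%N by move: (ltn_ord j) jm => /=; lia.
pose k := Ordinal mn.
have gk : gen (pm (tperm k j)).
  have := gen_simple k; rewrite /simple_refl; case: insubP => [j' _ /= ej|].
    by have -> // : j = j'; apply/val_inj => /=; move: jm ej => /= -> ->.
  by rewrite /=; move: (ltn_ord j) jm => /=; lia.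
have [eik|nik] := eqVneq i k; first by rewrite eik.
have gik : gen (pm (tperm i k)) by apply: IH; move: jm ltij => //=; lia.
have -> : tperm i j = (tperm k j * (tperm i k * tperm k j))%g.
  rewrite -[in LHS](tpermL k j) -{1}(@tpermD _ k j i) 1?eq_sym //.
  by rewrite -tpermJ conjgE tpermV.
by rewrite -!pmM; do !apply: gen_mul.
Qed.

Let gen_perm p : gen (pm p).
Proof.
have [ts -> _] := prod_tpermP p.
elim: ts => [|t ts IH]; first by rewrite big_nil; exact: gen_id.
by rewrite big_cons -pmM; apply: gen_mul.
Qed.

Let sg i : sperm n := (1%g, [ffun k => k == i]).

Let gen_sg i : gen (sg i).
Proof.
have n0 : (0 < n)%N by case: (i) => m /=; lia.
have ln : (n.-1 < n)%N by lia.
pose l := Ordinal ln.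
have gl : gen (sg l).
  have := gen_simple l; rewrite /simple_refl; case: insubP => //= j.
  by rewrite prednK ?ltnn.
have -> : sg i = sperm_mul (pm (tperm i l)) (sperm_mul (sg l) (pm (tperm i l))).
  congr (_, _); first by rewrite /= mul1g tperm2.
  apply/ffunP=> k; rewrite !ffunE /= addbF.
  by rewrite -{2}(tpermL i l) (inj_eq perm_inj).
by do !apply: gen_mul.
Qed.

Lemma sperm_gen w : exists k, has_word w k.
Proof.
suff [s sw] : gen w by exists (size s); apply/existsP; exists (in_tuple s); apply/eqP.
case: w => p s.
have -> : (p, s) = sperm_mul (1%g, s) (pm p).
  by congr (_, _); rewrite /= ?mul1g //; apply/ffunP=> i; rewrite !ffunE addbF.
apply: gen_mul; last exact: gen_perm.
have [m] := ubnP #|[set i | s i]|; elim: m s => // m IH s.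
have [s0 _|[i]] := set_0Vmem [set i | s i].
  suff -> : s = [ffun=> false] by exact: gen_id.
  by apply/ffunP=> i; rewrite ffunE; move/setP/(_ i): s0; rewrite !inE.
rewrite inE => si lt_m.
pose t := [ffun k => s k (+) (k == i)].
have -> : ((1%g, s) : sperm n) = sperm_mul (sg i) (1%g, t).
  congr (_, _); rewrite /= ?mul1g //; apply/ffunP=> k.
  by rewrite !ffunE perm1 addbC -addbA addbb addbF.
apply: gen_mul; first exact: gen_sg.
apply: IH; rewrite -ltnS; apply: leq_trans lt_m; rewrite ltnS.
apply: proper_card; apply/properP; split.
  apply/subsetP=> k; rewrite !inE ffunE.
  by have [->|] := eqVneq k i; rewrite ?si ?addbF.
by exists i; rewrite !inE ?si // ffunE si eqxx.
Qed.

End Sperm.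

(* The Coxeter length: the least number of simple reflections in a word for w. *)
Definition sperm_length (n : nat) (w : sperm n) : nat := ex_minn (sperm_gen w).

Definition KostkaFoulkes (n : nat) (lambda mu : weight n) : {poly int} :=
  \sum_(w : sperm n) (-1) ^+ sperm_length w *
     qpartition (sperm_act w (lambda + rho n) - (mu + rho n)).

(* K_{lambda,mu} for partitions given by their nonzero parts. *)
Definition KF (n : nat) (lambda mu : seq nat) : {poly int} :=
  KostkaFoulkes (part_weight n lambda) (part_weight n mu).

Section Height.
Variable n : nat.
Implicit Types (beta : weight n).

Let heightD : {morph @height n : b c / b + c}.
Proof.
by move=> b c; rewrite -big_split; apply: eq_bigr => i _; rewrite mxE mulrDr.
Qed.

Let heightN : {morph @height n : b / - b}.
Proof.
by move=> b; rewrite -sumrN; apply: eq_bigr => i _; rewrite mxE mulrN.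
Qed.

Let height0 : height (0 : weight n) = 0.
Proof. by apply: big1 => i _; rewrite mxE mulr0. Qed.

Let height_eps (i : 'I_n) : height (eps i) = (n - i)%N%:Z.
Proof.
rewrite /height (bigD1 i) //= mxE !eqxx mulr1 big1 ?addr0 // => j /negPf ji.
by rewrite mxE ji andbF mulr0.
Qed.

Let heightMn beta k : height (beta *+ k) = height beta *+ k.
Proof. by elim: k => [|k IH]; rewrite ?mulr0n ?height0 // !mulrS heightD IH. Qed.

Lemma height_pos_root (a : pos_root n) : 1 <= height (val a).
Proof.
case: a => a /=; rewrite !mem_cat => /or3P[] /mapP.
- case=> -[i j]; rewrite mem_filter => /andP[/= ij _] ->.
  by rewrite heightD heightN !height_eps; move: (ltn_ord j) (ij : (i < j)%N); lia.
- case=> -[i j] _ -> /=; rewrite heightD !height_eps.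
  by move: (ltn_ord i) (ltn_ord j); lia.
- by case=> i _ ->; rewrite heightMn height_eps; move: (ltn_ord i); lia.
Qed.

Lemma coef_qpartition beta k : (qpartition beta)`_k = (qpartition_coef beta k)%:Z.
Proof.
rewrite coef_poly; case: ifPn => // hk; rewrite /qpartition_coef.
rewrite (_ : [set m | _] = set0) ?cards0 //; apply/setP=> m; rewrite !inE.
apply/negP=> /andP[/eqP mk /eqP mb]; case/negP: hk; rewrite ltnS.
suff : k%:Z <= height beta by lia.
rewrite -mb (big_morph _ heightD height0) -{1}mk.
rewrite (big_morph Posz PoszD (erefl _)); apply: ler_sum => a _.
rewrite heightMn -mulr_natl natz -[leLHS]mulr1.
by apply: ler_wpM2l; [by [] | exact: height_pos_root].
Qed.

End Height.

(* Main.v *)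
Require Import Defs.
From HB Require Import structures.
From mathcomp Require Import all_boot all_order all_fingroup all_algebra.
From mathcomp Require Import zify ring.

(* Fix v = lambda + rho and u = mu + rho and look at the first coordinate of
   w v - u, which has to be nonnegative for a term of the alternating sum to
   survive.  The positive roots with nonzero first coordinate are 2 eps_1 and
   eps_1 + gamma, where gamma runs over the weights +-eps_j of the vector
   representation of C_(n-1); so if the first coordinate of w v - u is 0, 1 or 2,
   P_q in rank n is expressed by P_q in rank n-1, twisted by 1, by the vector
   representation, or by its symmetric square (and 2 eps_1).  As the weights
   gamma are permuted by the Weyl group, the twist can be moved onto lambda,
   where all but a few terms are killed by antisymmetry in v.  This yields a
   Morris-type recurrence in n; with K_2 = K_{(2),0} and K_11 = K_{(1,1),0},
     K_2(n+1)  = q + q^2 K_2(n),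
     K_11(n+1) = (q - 1) K_2(n) + q K_11(n) + q,
   and the other polynomials reduce to these in one step, except those with
   |lambda| - |mu| odd, which vanish because the root lattice is even.  The
   symmetric square is handled through 2 h_2 = p_1^2 + p_2. *)

Set Implicit Arguments.
Unset Strict Implicit.
Unset Printing Implicit Defensive.

Import Order.TTheory GRing.Theory Num.Theory.
Local Open Scope ring_scope.

(** * Vector partitions of an element into members of a list *)

Section VectorPartitions.
Variable V : zmodType.
Implicit Types (s L : seq V) (a b : V) (k : nat).

(** The coefficient of [q^k x^b] in the product of the [1/(1 - q x^a)] over [a] in [s], computed
    from [1/(1 - q x^a) = 1 + q x^a/(1 - q x^a)]. Repeated members of [s] count as distinct
    factors. *)
Fixpoint vpart s : V -> nat -> nat :=
  if s is a :: s' then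
    fix f b k {struct k} :=
      (vpart s' b k + if k is k'.+1 then f (b - a)%R k' else 0)%N
  else fun b k => (b == 0) && (k == 0%N).

Lemma vpart_cons0 a s b : vpart (a :: s) b 0 = vpart s b 0.
Proof. by rewrite /= addn0. Qed.

Lemma vpart_consS a s b k :
  vpart (a :: s) b k.+1 = (vpart s b k.+1 + vpart (a :: s) (b - a)%R k)%N.
Proof. by []. Qed.

Lemma vpart_swap a c s b k : vpart [:: a, c & s] b k = vpart [:: c, a & s] b k.
Proof.
elim/ltn_ind: k b => -[|k] IH b; first by rewrite !vpart_cons0.
rewrite (vpart_consS a) (vpart_consS c s) (vpart_consS c (_ :: _)) (vpart_consS a s).
rewrite (IH k _ (b - a)) // -(IH k _ (b - c)) //.
(* A second expansion brings both sides to [b - a - c], two steps below the start; hence the strong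
   induction. *)
case: k IH => [|k] IH; first by rewrite !vpart_cons0 addnAC.
rewrite (vpart_consS c _ (b - a)) (vpart_consS a _ (b - c)) (IH k) // (addrAC b).
by rewrite addnACA.
Qed.

Lemma eq_vpart_cons a s s' :
  vpart s =2 vpart s' -> vpart (a :: s) =2 vpart (a :: s').
Proof.
move=> e b k; elim: k b => [|k IH] b; first by rewrite !vpart_cons0 e.
by rewrite !vpart_consS e IH.
Qed.

Lemma perm_vpart s s' : perm_eq s s' -> vpart s =2 vpart s'.
Proof.
elim: s s' => [|a s IH] s' ss'.
  by move: ss'; rewrite perm_sym => /perm_nilP ->.
have as' : a \in s' by rewrite -(perm_mem ss') mem_head.
have [s1 [s2 es']] : exists s1 s2, s' = s1 ++ a :: s2.
  by case/splitPr: as' => s1 s2; exists s1, s2.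
have pe : vpart s =2 vpart (s1 ++ s2).
  by apply: IH; rewrite -(perm_cons a) (perm_trans ss') // es' perm_catC /= perm_cons perm_catC.
move=> b k; rewrite (eq_vpart_cons a pe) es' {ss' as' es' pe s IH s'}.
elim: s1 b k => // c s1 IH b k.
rewrite !cat_cons; exact: etrans (vpart_swap _ _ _ _ _) (eq_vpart_cons c IH b k).
Qed.

(** [Q] is an invariant of the recursion, which therefore never reaches 0. Later instances of [Q]
    are negative degree, nonzero degree and odd coordinate sum. *)
Lemma vpart_eq0 (Q : pred V) s b k :
    (forall a c, a \in s -> Q c -> Q (c - a)) -> ~~ Q 0 -> Q b ->
  vpart s b k = 0%N.
Proof.
elim: s b k => [|a s IH] b k Qs Q0 Qb.
  by rewrite /=; case: eqP Qb Q0 => //= -> ->.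
have Qs' c d : c \in s -> Q d -> Q (d - c).
  by move=> cs; apply: Qs; rewrite inE cs orbT.
elim: k b Qb => [|k IHk] b Qb; first by rewrite vpart_cons0 IH.
by rewrite vpart_consS IH // IHk // Qs ?mem_head.
Qed.

End VectorPartitions.

Lemma vpart_map (V U : zmodType) (f : {additive V -> U}) s b k :
  injective f -> vpart (map f s) (f b) k = vpart s b k.
Proof.
move=> f_inj; elim: s b k => [|a s IH] b k /=.
  by rewrite -(raddf0 f) (inj_eq f_inj).
by elim: k b => [|k IHk] b /=; rewrite IH // -IHk raddfB.
Qed.

Lemma vpart0 (V : zmodType) (s : seq V) b : vpart s b 0 = (b == 0).
Proof. by elim: s => [|a s IH] /=; rewrite ?andbT // addn0. Qed.

(** * Partitions graded by an additive degree *)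

Section GradedPartitions.
Variables (V : zmodType) (c : {additive V -> int}) (s L : seq V).
Hypothesis s0 : {in s, forall a, c a = 0}.
Hypothesis L1 : {in L, forall a, c a = 1}.
Implicit Types (b d : V) (k : nat).

Lemma vpart_deg_lt0 (t : seq V) b k :
  {in t, forall a, 0 <= c a} -> c b < 0 -> vpart t b k = 0%N.
Proof.
move=> t0 cb; apply: (@vpart_eq0 _ (fun d => c d < 0)); rewrite ?raddf0 //.
by move=> /= a d /t0 ca cd; rewrite raddfB subr_lt0; exact: lt_le_trans cd ca.
Qed.

Lemma vpart_deg_neq0 b k : c b != 0 -> vpart s b k = 0%N.
Proof.
move=> cb; apply: (@vpart_eq0 _ (fun d => c d != 0)); rewrite ?raddf0 ?eqxx //.
by move=> a d /s0 ca; rewrite raddfB ca subr0.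
Qed.

(** Taking any member of [t] would leave a negative degree, which members of nonnegative degree
    cannot make up. *)
Lemma vpart_deg0 (t : seq V) b k :
  {in t, forall a, 1 <= c a} -> c b = 0 -> vpart (t ++ s) b k = vpart s b k.
Proof.
elim: t k => // l t IH [|k] t1 cb; first by rewrite !vpart0.
rewrite cat_cons vpart_consS IH //; last by move=> a at_; rewrite t1 // inE at_ orbT.
rewrite (@vpart_deg_lt0 (l :: t ++ s)) ?addn0 //; last first.
  by rewrite raddfB cb sub0r oppr_lt0 (lt_le_trans _ (t1 l (mem_head _ _))).
by move=> a; rewrite -cat_cons mem_cat => /orP[/t1/(le_trans _)->|/s0->].
Qed.

(** Taking [d] uses up the whole degree, so the rest is a partition into members of [s]. Later [d]
    is [2 eps_1]. *)
Lemma vpart_deg_sub_head d b k : c d = c b -> 0 < c d ->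
  vpart (d :: L ++ s) b k.+1 = (vpart (L ++ s) b k.+1 + vpart s (b - d) k)%N.
Proof.
move=> cdb cd; rewrite vpart_consS -cat_cons (@vpart_deg0 (d :: L)) //.
  by move=> a; rewrite inE => /orP[/eqP->|/L1->].
by rewrite raddfB cdb subrr.
Qed.

Lemma vpart_deg1 b k : c b = 1 ->
  vpart (L ++ s) b k.+1 = \sum_(l <- L) vpart s (b - l) k.
Proof.
move=> cb; have : {subset L <= L} by [].
elim: {1 3 4}L => [|l L' IH] sL; first by rewrite big_nil vpart_deg_neq0 // cb.
have L'1 : {in l :: L', forall a, c a = 1} by move=> a /sL/L1.
rewrite big_cons cat_cons vpart_consS IH; last by move=> a al; rewrite sL // inE al orbT.
rewrite -cat_cons (@vpart_deg0 (l :: L')) 1?addnC //; first by move=> a /L'1 ->.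
by rewrite raddfB cb L'1 ?mem_head.
Qed.

End GradedPartitions.

(* The factor 2 turns the sum over unordered pairs, i.e. the complete symmetric
   function h_2, into p_1^2 + p_2. *)
Lemma vpart_deg2 (V : zmodType) (c : {additive V -> int}) (s L : seq V) b k :
    {in s, forall a, c a = 0} -> {in L, forall a, c a = 1} -> c b = 2 ->
  (2 * vpart (L ++ s) b k.+2 =
   \sum_(l <- L) \sum_(l' <- L) vpart s (b - l - l') k +
   \sum_(l <- L) vpart s (b - l - l) k)%N.
Proof.
move=> s0 L1 cb; elim: L L1 => [|l L IH] L1.
  by rewrite !big_nil (vpart_deg_neq0 s0) // cb.
have L1' : {in L, forall a, c a = 1} by move=> a al; rewrite L1 // inE al orbT.
rewrite cat_cons vpart_consS mulnDr IH // -cat_cons (vpart_deg1 s0 L1); last first.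
  by rewrite raddfB cb L1 ?mem_head.
have e : (\sum_(x <- L) \sum_(l' <- l :: L) vpart s (b - x - l') k =
    \sum_(x <- L) vpart s (b - l - x) k +
    \sum_(x <- L) \sum_(l' <- L) vpart s (b - x - l') k)%N.
  by rewrite -big_split; apply: eq_bigr => x _; rewrite big_cons (addrAC b).
rewrite !(big_cons _ _ l) e; set X := vpart _ _ _; set Y := (\sum_(j <- _) _)%N.
set Z := (\sum_(i <- _) _)%N; set T := (\sum_(i <- _) _)%N; lia.
Qed.

(** A single part has degree 0 or 1, so it cannot have degree 2. *)
Lemma vpart_deg2_small (V : zmodType) (c : {additive V -> int}) (s L : seq V) b :
    {in s, forall a, c a = 0} -> {in L, forall a, c a = 1} -> c b = 2 ->
  vpart (L ++ s) b 1 = 0%N.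
Proof.
move=> s0 L1 cb; elim: L L1 => [|l L IH] L1; first by rewrite (vpart_deg_neq0 s0) ?cb.
have L1' : {in L, forall a, c a = 1} by move=> a al; rewrite L1 // inE al orbT.
rewrite cat_cons vpart_consS IH // vpart0 add0n; case: eqP => // /(congr1 c).
by rewrite raddfB raddf0 cb L1 ?mem_head.
Qed.

(** * Multiplicity functions *)

Section CountMultiplicities.
Variables (I : finType) (V : zmodType) (v : I -> V) (K : nat).
Implicit Types (s : seq I) (b : V) (k : nat) (m : {ffun I -> 'I_K.+1}).

Definition mult_set s b k := [set m : {ffun I -> 'I_K.+1} |
  [&& [forall i, (i \notin s) ==> (m i == ord0)], (\sum_i m i)%N == k
    & \sum_i v i *+ m i == b]].

Definition mult_incr (a : I) m : {ffun I -> 'I_K.+1} :=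
  [ffun i => if i == a then inord (m i).+1 else m i].

Definition mult_decr (a : I) m : {ffun I -> 'I_K.+1} :=
  [ffun i => if i == a then inord (m i).-1 else m i].

Lemma mult_incr_a a m : (m a < K)%N -> mult_incr a m a = (m a).+1 :> nat.
Proof. by move=> ma; rewrite ffunE eqxx inordK. Qed.

Lemma mult_incr_sum a m : (m a < K)%N ->
  (\sum_i mult_incr a m i)%N = (\sum_i m i).+1 /\
  \sum_i v i *+ mult_incr a m i = v a + \sum_i v i *+ m i.
Proof.
move=> ma; rewrite !(bigD1 (P := xpredT) a) //= mult_incr_a //; split.
  by rewrite addSn; congr (_ + _).+1; apply: eq_bigr => i /negPf ia; rewrite ffunE ia.
by rewrite mulrS -addrA; congr (_ + (_ + _)); apply: eq_bigr => i /negPf ia; rewrite ffunE ia.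
Qed.

Lemma mult_decrK a m : (0 < m a)%N -> mult_incr a (mult_decr a m) = m.
Proof.
move=> ma; apply/ffunP=> i; rewrite !ffunE; have [->|//] := eqVneq i a.
rewrite (@inordK _ (m a).-1) ?prednK ?inord_val //.
exact: ltnW (ltn_ord _).
Qed.

(** The recursion of [vpart] splits the functions by their value at the head [a]: those with
    [m a = 0] are supported on the tail, the others arise by [mult_incr a] from total [k - 1]. The
    bound [k <= K] keeps the incremented value inside ['I_K.+1]. *)
Lemma card_mult_set s b k : uniq s -> (k <= K)%N ->
  #|mult_set s b k| = vpart (map v s) b k.
Proof.
elim: s b k => [|a s IHs] b k.
  move=> _ _ /=; have [/andP[/eqP b0 /eqP k0]|bk] := boolP (_ && _).
    rewrite b0 k0; apply: (@eq_card1 _ [ffun=> ord0]) => m; rewrite !inE.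
    apply/and3P/eqP => [[/forallP m0 _ _]|->].
      by apply/ffunP=> i; rewrite ffunE; apply/eqP/(implyP (m0 i)).
    split; first by apply/forallP=> i; rewrite ffunE.
      by rewrite big1 // => i _; rewrite ffunE.
    by rewrite big1 // => i _; rewrite ffunE.
  apply: eq_card0 => m; rewrite !inE; apply: contraNF bk => /and3P[/forallP m0 mk mb].
  have {}m0 i : m i = ord0 by apply/eqP/(implyP (m0 i)).
  rewrite -(eqP mk) -(eqP mb) !big1 ?eqxx // => i _; by rewrite m0.
case/andP=> a_s uniq_s; elim: k b => [|k IHk] b kK.
  rewrite map_cons vpart_cons0 -IHs //; apply: eq_card => m; rewrite !inE.
  have [m0|] := boolP (\sum_i m i == 0)%N; last by rewrite !andbF.
  have {}m0 i : m i = ord0.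
    by apply/val_inj/eqP; move: m0; rewrite sum_nat_eq0 => /forallP/(_ i).
  by congr (_ && _); apply/forallP/forallP => _ i; rewrite m0 eqxx implybT.
rewrite map_cons vpart_consS -map_cons -IHs // -(IHk (b - v a)) //; last exact: ltnW.
rewrite -(card_in_imset (f := mult_incr a) (D := mult_set (a :: s) (b - v a) k)); last first.
  move=> m m'; rewrite !inE => /and3P[_ mk _] /and3P[_ mk' _] /ffunP e.
  have lt_K (p : {ffun I -> 'I_K.+1}) : (\sum_i p i)%N == k -> (p a < K)%N.
    by move=> /eqP pk; apply: leq_ltn_trans kK; rewrite -pk (bigD1 a) //= leq_addr.
  have {mk}mk := lt_K m mk; have {mk'}mk' := lt_K m' mk'.
  apply/ffunP=> i; have [->|ia] := eqVneq i a.
    by have /(congr1 val) := e a; rewrite /= !mult_incr_a // => -[] /val_inj.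
  by have := e i; rewrite !ffunE (negPf ia).
(* The two pieces are disjoint: members of the first vanish at [a], members of the second do not. *)
rewrite -cardsUI [X in (_ + X)%N](_ : _ = 0%N) ?addn0; last first.
  apply/eqP; rewrite cards_eq0; apply/eqP/setP=> m; rewrite !inE; apply/negP.
  case/andP=> /and3P[/forallP/(_ a)/implyP/(_ a_s)/eqP ma _ _] /imsetP[m'].
  rewrite inE => /and3P[_ /eqP mk' _] em.
  have : (m' a < K)%N by apply: leq_ltn_trans kK; rewrite -mk' (bigD1 a) //= leq_addr.
  by move/mult_incr_a; rewrite -em ma.
apply: eq_card => m; rewrite in_setU.
have [ma|ma] := posnP (m a).
  have -> : (m \in mult_incr a @: mult_set (a :: s) (b - v a) k) = false.
    apply/negP=> /imsetP[m']; rewrite inE => /and3P[_ /eqP mk' _] em.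
    have : (m' a < K)%N by apply: leq_ltn_trans kK; rewrite -mk' (bigD1 a) //= leq_addr.
    by move/mult_incr_a; rewrite -em ma.
  rewrite orbF !inE; congr (_ && _); apply: eq_forallb => i; rewrite inE.
  have [->|//] := eqVneq i a; rewrite a_s /=; symmetry; exact/eqP/val_inj.
have -> : (m \in mult_set s b k.+1) = false.
  by rewrite inE; apply/negP => /and3P[/forallP/(_ a)/implyP/(_ a_s)/eqP m0]; move: ma; rewrite m0.
rewrite orFb -[in RHS](mult_decrK ma); set m' := mult_decr a m.
have m'K : (m' a < K)%N.
  have lK : ((m a).-1 < K)%N by rewrite -ltnS prednK ?ltn_ord.
  by rewrite /m' ffunE eqxx inordK //; exact: ltnW.
have [S1 S2] := mult_incr_sum m'K; rewrite mult_decrK // in S1 S2.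
have -> : (mult_incr a m' \in mult_incr a @: mult_set (a :: s) (b - v a) k) =
          (m' \in mult_set (a :: s) (b - v a) k).
  apply/imsetP/idP => [[m2 m2s] e|]; last by exists m'.
  suff -> : m' = m2 by [].
  have m2K : (m2 a < K)%N.
    move: m2s; rewrite inE => /and3P[_ /eqP mk' _].
    by apply: leq_ltn_trans kK; rewrite -mk' (bigD1 a) //= leq_addr.
  move/ffunP: e => e; apply/ffunP=> i; have [->|ia] := eqVneq i a.
    by have /(congr1 val) := e a; rewrite /= !mult_incr_a // => -[] /val_inj.
  by have := e i; rewrite ![mult_incr _ _ _]ffunE (negPf ia).
rewrite !inE S1 S2 eqSS [v a + _]addrC -subr_eq; congr [&& _, _ & _].
- apply: eq_forallb => i; rewrite inE ffunE.
  by have [->|] := eqVneq i a.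
- by rewrite subr_eq [RHS]eq_sym subr_eq eq_sym.
Qed.

End CountMultiplicities.

(** * Positive roots of rank n + 1 *)

Definition wcons n (a : int) (v : weight n) : weight n.+1 :=
  \row_i oapp (v 0) a (unlift ord0 i).

Lemma wcons0 n a (v : weight n) : wcons a v 0 ord0 = a.
Proof. by rewrite mxE unlift_none. Qed.

Lemma wconsS n a (v : weight n) i : wcons a v 0 (lift ord0 i) = v 0 i.
Proof. by rewrite mxE liftK. Qed.

Lemma eq_weightS n (u v : weight n.+1) :
    u 0 ord0 = v 0 ord0 -> (forall i, u 0 (lift ord0 i) = v 0 (lift ord0 i)) ->
  u = v.
Proof. by move=> uv0 uvS; apply/rowP=> i; case: (unliftP ord0 i) => [j|] ->. Qed.

Lemma wconsD n a b (u v : weight n) :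
  wcons a u + wcons b v = wcons (a + b) (u + v).
Proof. by apply: eq_weightS => [|i]; rewrite mxE ?wcons0 ?wconsS // mxE. Qed.

Lemma wconsN n a (u : weight n) : - wcons a u = wcons (- a) (- u).
Proof. by apply: eq_weightS => [|i]; rewrite mxE ?wcons0 ?wconsS // mxE. Qed.

Lemma wconsB n a b (u v : weight n) :
  wcons a u - wcons b v = wcons (a - b) (u - v).
Proof. by rewrite wconsN wconsD. Qed.

Lemma wcons_inj n a : injective (@wcons n a).
Proof. by move=> u v e; apply/rowP=> i; rewrite -(wconsS a u) e wconsS. Qed.

Definition wcoord0 n (v : weight n.+1) : int := v 0 ord0.

Fact wcoord0_additive n : zmod_morphism (@wcoord0 n).
Proof. by move=> u v; rewrite /wcoord0 !mxE. Qed.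
HB.instance Definition _ n := GRing.isZmodMorphism.Build _ _ _ (@wcoord0_additive n).

Fact wcons0_additive n : zmod_morphism (@wcons n 0).
Proof. by move=> u v; rewrite wconsB subrr. Qed.
HB.instance Definition _ n := GRing.isZmodMorphism.Build _ _ _ (@wcons0_additive n).

Lemma eps_ord0 n : eps ord0 = wcons 1 0 :> weight n.+1.
Proof. by apply: eq_weightS => [|i]; rewrite ?wcons0 ?wconsS !mxE. Qed.

Lemma eps_lift n (i : 'I_n) : eps (lift ord0 i) = wcons 0 (eps i) :> weight n.+1.
Proof.
apply: eq_weightS => [|j]; first by rewrite wcons0 mxE.
by rewrite wconsS !mxE (inj_eq lift_inj).
Qed.

(* The weights of the vector representation: (i, e) stands for (-1)^e eps_i. *)
Definition letter n (l : 'I_n * bool) : weight n := (-1) ^+ l.2 *: eps l.1.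

Lemma mem_pos_roots n (a : weight n) :
  reflect ((exists i j : 'I_n, exists2 e : bool, (i < j)%N & a = eps i + letter (j, e))
           \/ exists i, a = eps i *+ 2)
    (a \in pos_roots n).
Proof.
apply: (iffP idP).
  rewrite !mem_cat => /or3P[] /mapP[].
  - move=> [i j]; rewrite mem_filter /= => /andP[ij _] ->.
    by left; exists i, j, true; rewrite // /letter /= scaleN1r.
  - move=> [i j]; rewrite mem_filter /= => /andP[ij _] ->.
    by left; exists i, j, false; rewrite // /letter /= scale1r.
  - by move=> i _ ->; right; exists i.
rewrite !mem_cat => -[[i [j [e ij ->]]]|[i ->]].
  apply/or3P; case: e.
    constructor 1; apply/mapP; exists (i, j); rewrite /letter ?scaleN1r //.
    by rewrite mem_filter ij mem_enum.
  constructor 2; apply/mapP; exists (i, j); rewrite /letter ?scale1r //.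
  by rewrite mem_filter ij mem_enum.
by apply/or3P; constructor 3; apply/mapP; exists i; rewrite ?mem_enum.
Qed.

Definition letters n : seq (weight n) :=
  [seq letter l | l <- enum {: 'I_n * bool}].

Lemma letter_inj n : injective (@letter n).
Proof.
move=> [i e] [j f] /rowP eij; have := eij i; rewrite !mxE !eqxx /= mulr1.
have [<-|_] := eqVneq i j; last by rewrite mulr0; case: e {eij}.
by rewrite mulr1; case: e f {eij} => [] [].
Qed.

Lemma letter_lift n (j : 'I_n) e : letter (lift ord0 j, e) = wcons 0 (letter (j, e)).
Proof.
rewrite /letter eps_lift; apply: eq_weightS => [|i]; first by rewrite mxE !wcons0 mulr0.
by rewrite mxE !wconsS [in RHS]mxE.
Qed.

(** The first coordinate grades the roots in degrees 2, 1 and 0, and distinct degrees keep the three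
    pieces disjoint. *)
Lemma perm_pos_roots n :
  perm_eq (undup (pos_roots n.+1))
    (wcons 2 0 :: [seq wcons 1 v | v <- letters n] ++
       [seq wcons 0 v | v <- undup (pos_roots n)]).
Proof.
have hc (a b : int) (s : seq (weight n)) v : a != b -> wcons a v \notin map (wcons b) s.
  move=> ab; apply/mapP=> -[w _] /(congr1 (@wcoord0 n)).
  by rewrite /wcoord0 !wcons0; apply/eqP.
apply: uniq_perm; first exact: undup_uniq.
  rewrite /= mem_cat negb_or !hc // cat_uniq.
  rewrite !(map_inj_uniq (@wcons_inj _ _)) (map_inj_uniq (@letter_inj _)).
  rewrite enum_uniq undup_uniq /= andbT; apply/hasPn => _ /mapP[w _ ->].
  exact: hc.
move=> a; rewrite mem_undup in_cons [in RHS]mem_cat; apply/mem_pos_roots/or3P.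
  case=> [[i [j [e ij ->]]]|[i ->]]; last first.
    case: (unliftP ord0 i) => [i'|] ->; last first.
      by constructor 1; rewrite eps_ord0 mulr2n wconsD addr0.
    constructor 3; apply/mapP; exists (eps i' *+ 2); last first.
      by rewrite eps_lift !mulr2n wconsD.
    by rewrite mem_undup; apply/mem_pos_roots; right; exists i'.
  case: (unliftP ord0 j) ij => [j'|] -> //.
  case: (unliftP ord0 i) => [i'|] -> ij.
    constructor 3; rewrite eps_lift letter_lift wconsD addr0 map_f // mem_undup.
    apply/mem_pos_roots; left; exists i', j', e => //.
  constructor 2; rewrite eps_ord0 letter_lift wconsD addr0 add0r map_f //.
  by rewrite map_f ?mem_enum.
case=> [/eqP ->|/mapP[_ /mapP[[j e] _ ->] ->]|/mapP[b]].
- by right; exists ord0; symmetry; rewrite eps_ord0 mulr2n wconsD addr0.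
- left; exists ord0, (lift ord0 j), e => //.
  by rewrite eps_ord0 letter_lift wconsD addr0 add0r.
rewrite mem_undup => /mem_pos_roots[[i [j [e ij ->]]]|[i ->]] ->.
  left; exists (lift ord0 i), (lift ord0 j), e => //.
  by rewrite eps_lift letter_lift wconsD addr0.
by right; exists (lift ord0 i); rewrite eps_lift !mulr2n wconsD.
Qed.

Lemma qpartition_coef_vpart n (b : weight n) k :
  qpartition_coef b k = vpart (undup (pos_roots n)) b k.
Proof.
rewrite (@perm_vpart _ _ (map val (enum {: pos_root n}))).
  rewrite -(@card_mult_set _ _ _ k) ?enum_uniq //.
  apply: eq_card => m; rewrite !inE.
  by rewrite [X in _ = X && _](_ : _ = true) //; apply/forallP=> a; rewrite mem_enum.
apply: uniq_perm; rewrite ?undup_uniq ?(map_inj_uniq val_inj) ?enum_uniq //.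
move=> a; rewrite mem_undup; apply/idP/mapP => [ar|[x _ ->]]; last exact: valP.
by exists (SeqSub ar); rewrite ?mem_enum.
Qed.

Arguments vpart : simpl never.

Lemma coef_qpartition_vpart n (v : weight n) k :
  (qpartition v)`_k = (vpart (undup (pos_roots n)) v k)%:Z.
Proof. by rewrite coef_qpartition qpartition_coef_vpart. Qed.

Lemma coef_qpartitionS n (v : weight n.+1) k :
  (qpartition v)`_k = (vpart (wcons 2 0 :: [seq wcons 1 v | v <- letters n] ++
       [seq wcons 0 v | v <- undup (pos_roots n)]) v k)%:Z.
Proof. by rewrite coef_qpartition_vpart (perm_vpart (perm_pos_roots n)). Qed.

(** * The partition function at first coordinate at most 2 *)

Lemma wcoord0_wcons n a (v : weight n) : wcoord0 (wcons a v) = a.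
Proof. exact: wcons0. Qed.

Lemma wcoord0_level1 n :
  {in [seq wcons 1 v | v <- letters n], forall a, wcoord0 a = 1}.
Proof. by move=> a /mapP[v _ ->]; rewrite wcoord0_wcons. Qed.

Lemma wcoord0_level0 n :
  {in [seq wcons 0 v | v <- undup (pos_roots n)], forall a, wcoord0 a = 0}.
Proof. by move=> a /mapP[v _ ->]; rewrite wcoord0_wcons. Qed.

Lemma vpart_wcons0 n s (v : weight n) k :
  vpart [seq wcons 0 a | a <- s] (wcons 0 v) k = vpart s v k.
Proof. by rewrite (vpart_map (f := @wcons n 0)) //; exact: wcons_inj. Qed.

Lemma qpartition_wcons_lt0 n a (v : weight n) : a < 0 -> qpartition (wcons a v) = 0.
Proof.
move=> a0; apply/polyP=> k; rewrite coef0 coef_qpartitionS.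
rewrite (vpart_deg_lt0 (c := @wcoord0 n)) //; last by rewrite /= wcoord0_wcons.
move=> b /=.
rewrite in_cons mem_cat => /or3P[/eqP->|/wcoord0_level1->|/wcoord0_level0->] //.
by rewrite wcoord0_wcons.
Qed.

Lemma qpartition_wcons0 n (v : weight n) : qpartition (wcons 0 v) = qpartition v.
Proof.
apply/polyP=> k; rewrite coef_qpartitionS coef_qpartition_vpart -cat_cons.
rewrite (vpart_deg0 (@wcoord0_level0 n)) ?vpart_wcons0 //; last exact: wcoord0_wcons.
move=> b /=; rewrite in_cons => /orP[/eqP->|/wcoord0_level1->] //.
by rewrite wcoord0_wcons.
Qed.

Lemma sum_letters n (F : weight n -> nat) :
  (\sum_(v <- letters n) F v = \sum_l F (letter l))%N.
Proof. by rewrite big_map big_enum. Qed.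

(** The root [2 eps_1] is too large, so exactly one root [eps_1 + gamma] occurs; it contributes the
    factor ['X]. *)
Lemma qpartition_wcons1 n (v : weight n) :
  qpartition (wcons 1 v) = 'X * \sum_l qpartition (v - letter l).
Proof.
apply/polyP=> -[|k]; rewrite coef_qpartitionS coefXM /=.
  rewrite vpart0; case: eqP => // /(congr1 (@wcoord0 n)).
  by rewrite wcoord0_wcons raddf0.
rewrite vpart_consS [X in (_ + X)%N](vpart_deg_lt0 (c := @wcoord0 n)).
- rewrite addn0 (vpart_deg1 (@wcoord0_level0 n) (@wcoord0_level1 n)); last exact: wcoord0_wcons.
  rewrite big_map sum_letters coef_sum (big_morph Posz PoszD (erefl _)).
  apply: eq_bigr => l _.
  by rewrite wconsB subrr vpart_wcons0 coef_qpartition_vpart.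
- move=> b /=; rewrite in_cons mem_cat.
  case/or3P=> [/eqP->|/wcoord0_level1->|/wcoord0_level0->] //.
  by rewrite wcoord0_wcons.
- by rewrite wconsB /= wcoord0_wcons.
Qed.

(** First coordinate 2 comes either from [2 eps_1], with factor ['X], or from two roots
    [eps_1 + gamma], with factor ['X^2]. The second choice is unordered, hence the doubling. *)
Lemma qpartition_wcons2 n (v : weight n) :
  2 * qpartition (wcons 2 v) = 2 * ('X * qpartition v) +
    'X^2 * (\sum_l \sum_l' qpartition (v - letter l - letter l') +
            \sum_l qpartition (v - letter l - letter l)).
Proof.
have hd := vpart_deg_sub_head (@wcoord0_level0 n) (@wcoord0_level1 n).
have {}hd k := hd (wcons 2 0) (wcons 2 v) k (etrans (wcons0 _ _) (esym (wcons0 _ _))).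
have d0 : 0 < wcoord0 (wcons 2 (0 : weight n)) by rewrite wcoord0_wcons.
have {}hd k := hd k d0.
apply/polyP=> -[|[|k]]; rewrite !(mulr_natl, coefMn, coefD, coefXM, coefXnM) /=.
- rewrite coef_qpartitionS vpart0; case: eqP => [/(congr1 (@wcoord0 n))|_].
    by rewrite wcoord0_wcons raddf0.
  by rewrite mul0rn add0r.
(* With one root in all, only [2 eps_1] can supply first coordinate 2. *)
- rewrite coef_qpartitionS hd.
  rewrite (vpart_deg2_small (@wcoord0_level0 n) (@wcoord0_level1 n)); last exact: wcoord0_wcons.
  by rewrite wconsB subrr subr0 vpart_wcons0 add0n addr0 -coef_qpartition_vpart.
rewrite coef_qpartitionS hd PoszD mulrnDl addrC.
rewrite wconsB subrr subr0 vpart_wcons0 -coef_qpartition_vpart; congr (_ + _).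
rewrite -[LHS]mulr_natl natz -PoszM.
rewrite (vpart_deg2 k (@wcoord0_level0 n) (@wcoord0_level1 n)); last exact: wcoord0_wcons.
rewrite PoszD !(big_map (@wcons n 1)) !sum_letters !coef_sum !(big_morph Posz PoszD (erefl _)) !subSS subn0.
have E (a b : 'I_n * bool) : (vpart [seq wcons 0 v0 | v0 <- undup (pos_roots n)]
    (wcons 2 v - wcons 1 (letter a) - wcons 1 (letter b)) k)%:Z =
  (qpartition (v - letter a - letter b))`_k.
  by rewrite !wconsB vpart_wcons0 coef_qpartition_vpart.
congr (_ + _); apply: eq_bigr => a _; last exact: E.
rewrite coef_sum (big_map (@wcons n 1)) sum_letters (big_morph Posz PoszD (erefl _)).
by apply: eq_bigr => b _; exact: E.
Qed.

Lemma sum_weightB n (u v : weight n) :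
  \sum_i (u - v) 0 i = \sum_i u 0 i - \sum_i v 0 i.
Proof. by rewrite -sumrB; apply: eq_bigr => i _; rewrite !mxE. Qed.

Lemma sum_weightD n (u v : weight n) :
  \sum_i (u + v) 0 i = \sum_i u 0 i + \sum_i v 0 i.
Proof. by rewrite -big_split; apply: eq_bigr => i _; rewrite !mxE. Qed.

Lemma sum_eps n (i : 'I_n) : \sum_j eps i 0 j = 1.
Proof.
rewrite (bigD1 i) //= big1 => [|j /negPf ji]; first by rewrite mxE !eqxx addr0.
by rewrite mxE ji andbF.
Qed.

(** Every root has even coordinate sum, so oddness is an invariant for [vpart_eq0]. *)
Lemma qpartition_odd n (v : weight n) :
  ~~ (2 %| \sum_i v 0 i)%Z -> qpartition v = 0.
Proof.
move=> v_odd; apply/polyP=> k; rewrite coef0 coef_qpartition_vpart.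
rewrite (@vpart_eq0 _ (fun w : weight n => ~~ (2 %| \sum_i w 0 i)%Z)) //; last first.
  by rewrite big1 // => i _; rewrite mxE.
move=> a w; rewrite mem_undup sum_weightB.
have se (i : 'I_n) := sum_eps i.
case/mem_pos_roots=> [[i [j [e _ ->]]]|[i ->]].
  rewrite sum_weightD se.
  have -> : \sum_k letter (j, e) 0 k = (-1) ^+ e * \sum_k eps j 0 k.
    by rewrite mulr_sumr; apply: eq_bigr => k0 _; rewrite mxE.
  rewrite se; set x := \sum_i _.
  by case: e; rewrite ?expr1 ?expr0 mulr1; lia.
by rewrite mulr2n sum_weightD se; set x := \sum_i _; lia.
Qed.

(** * Signs and antisymmetry *)

Section Sign.
Variable n : nat.
Implicit Types (u v w : sperm n).

(** The exponent of the determinant of the signed permutation matrix. Being a homomorphism that is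
    odd on simple reflections, it gives the parity of the length. *)
Definition sperm_odd w := odd_perm w.1 (+) \big[addb/false]_i w.2 i.

Lemma sperm_odd_mul u v : sperm_odd (sperm_mul u v) = sperm_odd u (+) sperm_odd v.
Proof.
rewrite /sperm_odd /= odd_permM.
under eq_bigr do rewrite ffunE.
rewrite big_split /= [in RHS](reindex_inj (F := v.2) (@perm_inj _ u.1)) /=.
by rewrite addbACA.
Qed.

Lemma sperm_odd_perm (p : 'S_n) : sperm_odd (p, [ffun=> false]) = p.
Proof. by rewrite /sperm_odd big1 ?addbF // => i _; rewrite ffunE. Qed.

Lemma sperm_odd_sign (i : 'I_n) : sperm_odd (1%g, [ffun k => k == i]).
Proof.
rewrite /sperm_odd odd_perm1 (bigD1 i) //= ffunE eqxx big1 // => j /negPf ji.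
by rewrite ffunE ji.
Qed.

Lemma sperm_odd_simple (i : 'I_n) : sperm_odd (simple_refl i).
Proof.
rewrite /simple_refl; case: insubP => [j _ ji|_]; last exact: sperm_odd_sign.
rewrite sperm_odd_perm odd_tperm; apply/eqP => ij.
by move: ji; rewrite ij /=; lia.
Qed.

Lemma sperm_odd_word (s : seq 'I_n) : sperm_odd (sperm_word s) = odd (size s).
Proof.
elim: s => [|i s IH]; first by rewrite /= sperm_odd_perm odd_perm1.
by rewrite /= sperm_odd_mul sperm_odd_simple IH.
Qed.

Lemma odd_sperm_length w : odd (sperm_length w) = sperm_odd w.
Proof.
rewrite /sperm_length; case: ex_minnP => k /existsP[s /eqP <-] _.
by rewrite sperm_odd_word size_tuple.
Qed.

Lemma sperm_mulI w : injective ((@sperm_mul n)^~ w).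
Proof.
move=> [p s] [p' s'] [/mulIg <- /ffunP e]; congr (_, _); apply/ffunP=> i.
by have := e i; rewrite !ffunE /= => /addIb.
Qed.

End Sign.

Lemma polyint_eqN (p : {poly int}) : p = - p -> p = 0.
Proof.
move=> e; apply/polyP=> k; have /eqP := congr1 (fun q : {poly int} => q`_k) e.
by rewrite coef0 coefN -subr_eq0 opprK -mulr2n mulrn_eq0 => /eqP.
Qed.

(** Both weights are already shifted by [rho], and [v] is arbitrary, because straightening evaluates
    the sum at [v] that need not be dominant. *)
Definition altsum n (v u : weight n) : {poly int} :=
  \sum_(w : sperm n) (-1) ^+ sperm_odd w * qpartition (sperm_act w v - u).

Lemma KostkaFoulkesE n (lambda mu : weight n) :
  KostkaFoulkes lambda mu = altsum (lambda + rho n) (mu + rho n).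
Proof. by apply: eq_bigr => w _; rewrite -odd_sperm_length signr_odd. Qed.

Section Altsum.
Variable n : nat.
Implicit Types (v u : weight n) (w : sperm n).

(** Right translation by [w] permutes the group. This antisymmetry kills the sum at every [v] fixed
    by a reflection. *)
Lemma altsum_act w v u :
  altsum (sperm_act w v) u = (-1) ^+ sperm_odd w * altsum v u.
Proof.
rewrite [in RHS]/altsum (reindex_inj (@sperm_mulI n w)) mulr_sumr.
apply: eq_bigr => x _; rewrite sperm_act_mul sperm_odd_mul mulrA; congr (_ * _).
by rewrite signr_addb mulrCA -expr2 sqrr_sign mulr1.
Qed.

Lemma act_tpermE (i j : 'I_n) v k :
  sperm_act (tperm i j, [ffun=> false]) v 0 k = v 0 (tperm i j k).
Proof. by rewrite mxE ffunE expr0 mul1r. Qed.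

Lemma altsum_swap (i j : 'I_n) v v' u : i != j ->
    v' 0 i = v 0 j -> v' 0 j = v 0 i ->
    (forall k, k != i -> k != j -> v' 0 k = v 0 k) ->
  altsum v' u = - altsum v u.
Proof.
move=> ij vi vj vk; rewrite -mulN1r -[X in X * _]expr1.
suff -> : v' = sperm_act (tperm i j, [ffun=> false]) v.
  by rewrite altsum_act sperm_odd_perm odd_tperm ij.
apply/rowP=> k; rewrite act_tpermE; case: tpermP => [->|->|ki kj] //.
by apply: vk; exact/eqP.
Qed.

Lemma altsum_eq_coord (i j : 'I_n) v u : i != j -> v 0 i = v 0 j -> altsum v u = 0.
Proof. by move=> ij vij; apply: polyint_eqN; apply: (@altsum_swap i j v v u). Qed.

Lemma altsum_neg (i : 'I_n) v v' u :
    v' 0 i = - v 0 i -> (forall k, k != i -> v' 0 k = v 0 k) ->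
  altsum v' u = - altsum v u.
Proof.
move=> vi vk; rewrite -mulN1r -[X in X * _]expr1.
suff -> : v' = sperm_act (1%g, [ffun k => k == i]) v.
  by rewrite altsum_act sperm_odd_sign.
apply/rowP=> k; rewrite mxE /= ffunE perm1; have [->|ki] := eqVneq k i.
  by rewrite mulN1r.
by rewrite mul1r vk.
Qed.

Lemma altsum_coord0 (i : 'I_n) v u : v 0 i = 0 -> altsum v u = 0.
Proof.
by move=> vi; apply: polyint_eqN; apply: (altsum_neg (i := i)); rewrite // vi oppr0.
Qed.

Lemma sum_act_mod2 w v :
  (2 %| \sum_i sperm_act w v 0 i - \sum_i v 0 i)%Z.
Proof.
rewrite [X in _ - X](reindex_inj (@perm_inj _ w.1)) -sumrB; apply: rpred_sum => i _.
rewrite mxE; case: (w.2 i); rewrite ?mul1r ?subrr //.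
by rewrite mulN1r -opprD -mulr2n rpredN; apply/dvdzP; exists (v 0 (w.1 i)); rewrite mulr_natr.
Qed.

Lemma altsum_odd v u : ~~ (2 %| \sum_i v 0 i - \sum_i u 0 i)%Z -> altsum v u = 0.
Proof.
move=> vu; apply: big1 => w _; rewrite qpartition_odd ?mulr0 // sum_weightB.
apply: contra vu; have := sum_act_mod2 w v.
by set x := \sum_i _; set y := \sum_i _; set z := \sum_i _; lia.
Qed.

End Altsum.

(** * Cosets of the stabiliser of the first coordinate *)

Section FirstCoordinate.
Variable n : nat.
Implicit Types (v u : weight n.+1) (w : sperm n).

Definition sperm_lift w : sperm n.+1 :=
  (lift_perm ord0 ord0 w.1, [ffun i => oapp w.2 false (unlift ord0 i)]).

Lemma sperm_lift_act w a (v : weight n) :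
  sperm_act (sperm_lift w) (wcons a v) = wcons a (sperm_act w v).
Proof.
apply: eq_weightS => [|i]; rewrite mxE /= ffunE.
  by rewrite unlift_none lift_perm_id !wcons0 mul1r.
by rewrite liftK lift_perm_lift !wconsS mxE.
Qed.

Lemma sperm_odd_lift w : sperm_odd (sperm_lift w) = sperm_odd w.
Proof.
rewrite /sperm_odd odd_lift_perm /=; congr (_ (+) _).
rewrite big_ord_recl ffunE unlift_none; apply: eq_bigr => i _.
by rewrite ffunE liftK.
Qed.

Lemma sperm_lift_inj : injective sperm_lift.
Proof.
move=> [p s] [p' s'] [/permP ep /ffunP es]; congr (_, _).
  by apply/permP=> i; have := ep (lift ord0 i); rewrite !lift_perm_lift => /lift_inj.
by apply/ffunP=> i; have := es (lift ord0 i); rewrite !ffunE liftK.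
Qed.

Lemma sperm_liftP (w : sperm n.+1) :
  w.1 ord0 = ord0 -> ~~ w.2 ord0 -> exists w', w = sperm_lift w'.
Proof.
case: w => p s /= p0 s0.
pose f k := odflt k (unlift ord0 (p (lift ord0 k))).
have fK k : lift ord0 (f k) = p (lift ord0 k).
  rewrite /f; case: unliftP => [j -> //|/=].
  by move=> e; have := neq_lift ord0 k; rewrite -(inj_eq (@perm_inj _ p)) p0 e eqxx.
have f_inj : injective f.
  by move=> i j /(congr1 (lift ord0)); rewrite !fK => /perm_inj/lift_inj.
exists (perm f_inj, [ffun i => s (lift ord0 i)]); congr (_, _).
  apply/permP=> i; case: (unliftP ord0 i) => [j|] ->; last by rewrite lift_perm_id.
  by rewrite lift_perm_lift permE fK.
apply/ffunP=> i; rewrite !ffunE; case: (unliftP ord0 i) => [j|] ->.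
  by rewrite /= ffunE.
by rewrite /= (negPf s0).
Qed.

Definition firstsum v u : {poly int} :=
  \sum_w (-1) ^+ sperm_odd w * qpartition (sperm_act (sperm_lift w) v - u).

Lemma qpartition_lt0 v : v 0 ord0 < 0 -> qpartition v = 0.
Proof.
move=> v0; rewrite (_ : v = wcons (v 0 ord0) (\row_i v 0 (lift ord0 i))).
  exact: qpartition_wcons_lt0.
by apply: eq_weightS => [|i]; rewrite ?wcons0 // wconsS mxE.
Qed.

Lemma firstsum_lt0 v u : v 0 ord0 < u 0 ord0 -> firstsum v u = 0.
Proof.
move=> vu; apply: big1 => w _; rewrite qpartition_lt0 ?mulr0 //.
by rewrite !mxE /= ffunE unlift_none lift_perm_id mul1r subr_lt0.
Qed.

(** An element that puts some [- v 0 i] in first place makes the first coordinate of [w v - u]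
    negative, by the hypothesis. The remaining elements form cosets of the stabiliser, represented
    by the transpositions of [ord0] and [j]. *)
Lemma altsum_firstsum v u : (forall i, - u 0 ord0 < v 0 i) ->
  altsum v u = \sum_j (-1) ^+ (ord0 != j) *
    firstsum (sperm_act (tperm ord0 j, [ffun=> false]) v) u.
Proof.
move=> uv; rewrite /altsum (bigID (fun w : sperm n.+1 => w.2 ord0)) /= big1 => [|w w0].
  rewrite add0r (partition_big (fun w : sperm n.+1 => w.1 ord0) xpredT) //=.
  apply: eq_bigr => j _; pose t : sperm n.+1 := (tperm ord0 j, [ffun=> false]).
  (* [h] maps the group of rank [n] bijectively onto the elements that send [ord0] to [j] with no
     sign there. *)
  pose h w := sperm_mul (sperm_lift w) t.
  have h_inj : injective h by move=> x y /sperm_mulI/sperm_lift_inj.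
  rewrite mulr_sumr (eq_bigl (mem (h @: setT))) => [|w].
    rewrite big_imset /=; last by move=> x y _ _; exact: h_inj.
    apply: congr_big => // [w|w _]; first by rewrite inE.
    rewrite sperm_odd_mul sperm_odd_lift sperm_odd_perm odd_tperm sperm_act_mul mulrA.
    by rewrite signr_addb [(-1) ^+ sperm_odd w * _]mulrC.
  apply/andP/imsetP => [[w0 /eqP wj]|[x _ ->]]; last first.
    by rewrite /= permM lift_perm_id tpermL eqxx !ffunE unlift_none.
  have [||w' ew] := @sperm_liftP (sperm_mul w t).
  - by rewrite /= permM wj tpermR.
  - by rewrite /= !ffunE addbF.
  exists w' => //; rewrite /h -ew -sperm_mulA (_ : sperm_mul t t = sperm_id _) ?sperm_1mul //.
  by congr (_, _); rewrite /= ?tperm2 //; apply/ffunP=> i; rewrite !ffunE.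
rewrite qpartition_lt0 ?mulr0 // !mxE w0 mulN1r; have := uv (w.1 ord0).
by set x := v 0 _; set y := u 0 _; lia.
Qed.

End FirstCoordinate.

(** * Expansion along the first coordinate *)

Section LetterAction.
Variable n : nat.
Implicit Types (u v : weight n) (w : sperm n) (l : 'I_n * bool).

Lemma sperm_actD w u v : sperm_act w (u + v) = sperm_act w u + sperm_act w v.
Proof. by apply/rowP=> i; rewrite !mxE mulrDr. Qed.

Lemma sperm_actN w u : sperm_act w (- u) = - sperm_act w u.
Proof. by apply/rowP=> i; rewrite !mxE mulrN. Qed.

Lemma sperm_act_inj w : injective (sperm_act w).
Proof.
move=> u v /rowP e; apply/rowP=> i; have := e ((w.1^-1)%g i).
by rewrite !mxE permKV => /(can_inj (signrMK _)).
Qed.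

Lemma letterE l k : letter l 0 k = (-1) ^+ l.2 * (k == l.1)%:R.
Proof. by rewrite !mxE eqxx. Qed.

Definition act_letter w l := ((w.1^-1)%g l.1, l.2 (+) w.2 ((w.1^-1)%g l.1)).

Lemma sperm_act_letter w l : sperm_act w (letter l) = letter (act_letter w l).
Proof.
apply/rowP=> k; rewrite mxE !letterE /= (canF_eq (permK _)) mulrA -signr_addb addbC.
by case: eqP => [->//|_]; rewrite !mulr0.
Qed.

Lemma sum_act_letters (R : nmodType) (F : weight n -> R) w :
  \sum_l F (sperm_act w (letter l)) = \sum_l F (letter l).
Proof.
have act_letter_inj : injective (act_letter w).
  move=> l l' /(congr1 (@letter n)).
  by rewrite -!sperm_act_letter => /sperm_act_inj/letter_inj.
rewrite [RHS](reindex_inj act_letter_inj).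
by apply: eq_bigr => l _; rewrite sperm_act_letter.
Qed.

Lemma letterN l : letter (l.1, ~~ l.2) = - letter l.
Proof. by rewrite /letter signrN scaleNr. Qed.

Lemma sum_letterN (R : nmodType) (F : weight n -> R) :
  \sum_l F (- letter l) = \sum_l F (letter l).
Proof.
rewrite [RHS](reindex_inj (inv_inj (_ : involutive (fun l => (l.1, ~~ l.2))))).
  by apply: eq_bigr => l _; rewrite letterN.
by case=> i e; rewrite /= negbK.
Qed.

(** The letters are permuted by [w] and by negation, so each may be replaced by minus its image
    under [w] and absorbed into [v]. An arbitrary [F] allows a second shift inside the first. *)
Lemma sum_letters_shift (R : nmodType) (F : weight n -> R) w v u :
  \sum_l F (sperm_act w v - u - letter l) = \sum_l F (sperm_act w (v + letter l) - u).
Proof.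
rewrite -(sum_act_letters (fun x => F (sperm_act w v - u - x)) w).
rewrite -(sum_letterN (fun x => F (sperm_act w v - u - sperm_act w x))).
by apply: eq_bigr => l _; rewrite sperm_actD sperm_actN opprK addrAC.
Qed.

Lemma altsum_letter_shift v u :
  \sum_l altsum v (u + letter l) = \sum_l altsum (v + letter l) u.
Proof.
rewrite exchange_big [RHS]exchange_big; apply: eq_bigr => w _ /=.
rewrite -!mulr_sumr -(sum_letters_shift (@qpartition n)); congr (_ * _).
by apply: eq_bigr => l _; rewrite opprD addrA.
Qed.

Lemma firstsum_wcons a b v u :
  firstsum (wcons a v) (wcons b u) =
  \sum_w (-1) ^+ sperm_odd w * qpartition (wcons (a - b) (sperm_act w v - u)).
Proof. by apply: eq_bigr => w _; rewrite sperm_lift_act wconsB. Qed.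

Lemma firstsum_eq a v u : firstsum (wcons a v) (wcons a u) = altsum v u.
Proof.
rewrite firstsum_wcons subrr; apply: eq_bigr => w _.
by rewrite qpartition_wcons0.
Qed.

Lemma firstsum_diff1 a b v u : a - b = 1 ->
  firstsum (wcons a v) (wcons b u) = 'X * \sum_l altsum (v + letter l) u.
Proof.
move=> ab; rewrite firstsum_wcons ab exchange_big mulr_sumr.
apply: eq_bigr => w _; rewrite qpartition_wcons1 sum_letters_shift.
by rewrite mulrCA mulr_sumr.
Qed.

Lemma firstsum_diff2 a b v u : a - b = 2 ->
  2 * firstsum (wcons a v) (wcons b u) =
  2 * ('X * altsum v u) +
  'X^2 * (\sum_l \sum_l' altsum (v + letter l + letter l') u +
          \sum_l altsum (v + letter l + letter l) u).
Proof.
move=> ab; rewrite firstsum_wcons ab.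
have -> : \sum_l \sum_l' altsum (v + letter l + letter l') u =
    \sum_w (-1) ^+ sperm_odd w *
      \sum_l \sum_l' qpartition (sperm_act w v - u - letter l - letter l').
  under eq_bigr do rewrite exchange_big.
  rewrite exchange_big; apply: eq_bigr => w _ /=.
  under eq_bigr do rewrite -mulr_sumr.
  rewrite -mulr_sumr; congr (_ * _).
  rewrite (sum_letters_shift (fun x => \sum_l' qpartition (x - letter l'))).
  by apply: eq_bigr => l _; rewrite sum_letters_shift.
have -> : \sum_l altsum (v + letter l + letter l) u =
    \sum_w (-1) ^+ sperm_odd w *
      \sum_l qpartition (sperm_act w v - u - letter l - letter l).
  rewrite exchange_big; apply: eq_bigr => w _; rewrite -mulr_sumr; congr (_ * _).
  (* The doubled letter is a function of one letter, so one substitution by [w] and one by negation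
     move both copies. *)
  under [RHS]eq_bigr do rewrite -addrA -opprD.
  rewrite -(sum_act_letters (fun x => qpartition (sperm_act w v - u - (x + x))) w).
  rewrite -(sum_letterN (fun x => qpartition (sperm_act w v - u - (sperm_act w x + sperm_act w x)))).
  apply: eq_bigr => l _; congr qpartition.
  by rewrite !sperm_actD !sperm_actN -opprD opprK [RHS]addrAC !addrA.
rewrite /altsum -big_split /= !mulr_sumr -big_split; apply: eq_bigr => w _ /=.
rewrite mulrCA qpartition_wcons2; move: (_ ^+ _) (qpartition _) (\sum_l _) (\sum_l _).
by move=> s P A B; ring.
Qed.

End LetterAction.

(** * Straightening *)

Section Straightening.
Variable n : nat.
Implicit Types (u v : weight n.+1) (i j k : 'I_n.+1).
Local Notation R := (rho n.+1).
Local Notation e i := (letter (i, false)).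
Local Notation e0 := (letter (ord0, false)).

Lemma rhoE i : R 0 i = n.+1%:Z - i%:Z.
Proof. by rewrite mxE; have := ltn_ord i; lia. Qed.

Lemma letter_coord i (b : bool) k :
  letter (i, b) 0 k = if k == i :> nat then if b then -1 else 1 else 0.
Proof.
rewrite letterE /= -val_eqE /=; case: eqP => _; rewrite ?mulr0 ?mulr1 //.
by case: b.
Qed.

Lemma weightD u v i : (u + v) 0 i = u 0 i + v 0 i.
Proof. exact: mxE. Qed.

Lemma altsum_eq_coord_nat (a b : nat) v u : (a < n.+1)%N -> (b < n.+1)%N -> a != b ->
  v 0 (inord a) = v 0 (inord b) -> altsum v u = 0.
Proof.
move=> an bn ab; apply: altsum_eq_coord; apply: contra ab => /eqP/(congr1 val).
by rewrite /= !inordK // => ->.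
Qed.

Lemma sum_pair_letters (S : nmodType) (F : 'I_n.+1 * bool -> S) :
  \sum_l F l = \sum_i F (i, false) + \sum_i F (i, true).
Proof.
rewrite -big_split (eq_bigr (fun l => F (l.1, l.2))) => [|[] //].
rewrite -(pair_bigA _ (fun i b => F (i, b))).
by apply: eq_bigr => i _; rewrite big_bool /= addrC.
Qed.

Lemma sum_ord_first (S : nmodType) (F : 'I_n.+1 -> S) :
  (forall i, (0 < i)%N -> F i = 0) -> \sum_i F i = F ord0.
Proof.
move=> F0; rewrite (bigD1 ord0) //= big1 ?addr0 // => i i0.
by apply: F0; rewrite lt0n.
Qed.

Lemma sum_ord_last (S : nmodType) (F : 'I_n.+1 -> S) :
  (forall i, (i < n)%N -> F i = 0) -> \sum_i F i = F ord_max.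
Proof.
move=> F0; rewrite (bigD1 ord_max) //= big1 ?addr0 // => i im.
by apply: F0; rewrite ltn_neqAle im -ltnS ltn_ord.
Qed.

Lemma sum_ord_first2 (S : nmodType) (F : 'I_n.+1 -> S) :
    (forall i, (1 < i)%N -> F i = 0) ->
  \sum_i F i = F ord0 + \sum_(i < n.+1 | i == 1%N :> nat) F i.
Proof.
move=> F0; rewrite (bigD1 ord0) //=; congr (_ + _).
rewrite big_mkcond [RHS]big_mkcond; apply: eq_bigr => i _.
have [->//|i0] := eqVneq i ord0; have [//|i1] := eqVneq (i : nat) 1%N.
by apply: F0; move: i0 i1; rewrite -val_eqE /=; lia.
Qed.

(** Adding [eps i] with [i > 0] to [rho] makes coordinates [i] and [i - 1] equal; subtracting it
    makes coordinate [i] equal to the next one, or zero at the end. Either way the alternating sum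
    vanishes. *)
Lemma straighten_vector u :
  \sum_l altsum (R + letter l) u = altsum (R + e0) u.
Proof.
rewrite sum_pair_letters [X in _ + X]big1 ?addr0 => [|i _].
  apply: sum_ord_first => i i0; have ltin := ltn_ord i.
  apply: (@altsum_eq_coord_nat i i.-1); try lia.
  rewrite !weightD !rhoE !letter_coord !inordK; try lia.
  by rewrite eqxx ifF; lia.
have ltin := ltn_ord i; have [im|im] := eqVneq (i : nat) n.
  by apply: (@altsum_coord0 _ i); rewrite weightD rhoE letter_coord eqxx im; lia.
apply: (@altsum_eq_coord_nat i i.+1); try lia.
rewrite !weightD !rhoE !letter_coord !inordK; try lia.
by rewrite eqxx ifF; lia.
Qed.

(* A sum with at most one term: it is empty in rank 1, where (1,1) is not a weight. *)
Definition hook11 u : {poly int} :=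
  \sum_(i < n.+1 | i == 1%N :> nat) altsum (R + e0 + e i) u.

(** This is the decomposition of the tensor square of the vector representation into (2), (1,1) and
    the trivial one. The surviving letters are plus the first and second basis vectors and minus the
    first. *)
Lemma straighten_vector_vector u :
  \sum_l altsum (R + e0 + letter l) u =
  altsum (R + e0 + e0) u + hook11 u + altsum R u.
Proof.
rewrite sum_pair_letters; congr (_ + _).
  apply: sum_ord_first2 => i i0; have ltin := ltn_ord i.
  apply: (@altsum_eq_coord_nat i i.-1); try lia.
  rewrite !weightD !rhoE !letter_coord !inordK; try lia.
  by rewrite eqxx !ifF /=; lia.
rewrite sum_ord_first => [|i i0].
  by congr altsum; apply/rowP=> k; rewrite !weightD !letter_coord; case: eqP => _; lia.
have ltin := ltn_ord i; have [im|im] := eqVneq (i : nat) n.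
  by apply: (@altsum_coord0 _ i); rewrite !weightD rhoE !letter_coord eqxx ifF /=; lia.
apply: (@altsum_eq_coord_nat i i.+1); try lia.
rewrite !weightD !rhoE !letter_coord !inordK; try lia.
by rewrite eqxx !ifF /=; lia.
Qed.

(** This is the power sum [p_2], the symmetric minus the exterior square. Adding twice the second
    basis vector to [rho] gives [R + e0 + e i] with its first two coordinates swapped, hence
    [- hook11 u]; subtracting twice the last one turns the final coordinate 1 into -1, hence
    [- altsum R u]. *)
Lemma straighten_double u :
  \sum_l altsum (R + letter l + letter l) u =
  altsum (R + e0 + e0) u - hook11 u - altsum R u.
Proof.
rewrite sum_pair_letters; congr (_ + _).
  rewrite sum_ord_first2 => [|i i0].
    congr (_ + _); rewrite -sumrN; apply: eq_bigr => i /eqP i1.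
    have i0 : ord0 != i by rewrite -val_eqE /= i1.
    apply: (altsum_swap (v := R + e0 + e i) (v' := R + e i + e i) u i0) => [||k k0 ki].
    - by rewrite !weightD !rhoE !letter_coord /= i1 /=; lia.
    - by rewrite !weightD !rhoE !letter_coord /= i1 /=; lia.
    - by rewrite !weightD !letter_coord !val_eqE (negPf k0) (negPf ki).
  have ltin := ltn_ord i.
  apply: (@altsum_eq_coord_nat i i.-2); try lia.
  rewrite !weightD !rhoE !letter_coord !inordK; try lia.
  by rewrite eqxx !ifF /=; lia.
rewrite sum_ord_last => [|i im].
  apply: (altsum_neg (i := ord_max)) => [|k km].
    by rewrite !weightD !rhoE !letter_coord eqxx /=; lia.
  by rewrite !weightD !letter_coord !val_eqE (negPf km) !addr0.
have ltin := ltn_ord i; have [im'|im'] := eqVneq i.+1 n.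
  by apply: (@altsum_coord0 _ i); rewrite !weightD rhoE !letter_coord eqxx; lia.
apply: (@altsum_eq_coord_nat i i.+2); try lia.
rewrite !weightD !rhoE !letter_coord !inordK; try lia.
by rewrite eqxx !ifF /=; lia.
Qed.

(** The symmetric square of the vector representation is irreducible: [hook11] and the trivial term
    cancel between [p_1^2] and [p_2]. *)
Lemma straighten_sym2 u :
  \sum_l \sum_l' altsum (R + letter l + letter l') u +
  \sum_l altsum (R + letter l + letter l) u = 2 * altsum (R + e0 + e0) u.
Proof.
(* The inner letter is parked on [u], so that the outer sum starts from [rho] and straightens to one
   term; the parked letter then returns. *)
under eq_bigr do rewrite -altsum_letter_shift.
rewrite exchange_big; under eq_bigr do rewrite straighten_vector.
rewrite (altsum_letter_shift (R + e0)) (straighten_vector_vector u).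
rewrite (straighten_double u).
move: (altsum _ _) (altsum _ _) (hook11 u) => A B C; ring.
Qed.

End Straightening.

(** * Recurrences for the Kostka-Foulkes polynomials *)

Lemma rhoS n : rho n.+1 = wcons n.+1%:Z (rho n).
Proof.
by apply: eq_weightS => [|i]; rewrite ?wcons0 ?wconsS !mxE ?subn0 ?lift0 ?subSS.
Qed.

Lemma part_weight_cons n a s : part_weight n.+1 (a :: s) = wcons a%:Z (part_weight n s).
Proof.
by apply: eq_weightS => [|i]; rewrite ?wcons0 ?wconsS !mxE //= lift0.
Qed.

Lemma part_weight_nil n : part_weight n [::] = 0.
Proof. by apply/rowP=> i; rewrite !mxE nth_nil. Qed.

Lemma part_weight0 n : part_weight n [:: 0%N] = part_weight n [::].
Proof. by apply/rowP=> -[[|i] ilt]; rewrite !mxE //= !nth_nil. Qed.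

Lemma sum_part_weight n s : \sum_i part_weight n s 0 i = (sumn (take n s))%:Z.
Proof.
elim: n s => [|n IH] s; first by rewrite big_ord0 take0.
case: s => [|a s]; first by rewrite part_weight_nil big1 // => i _; rewrite mxE.
rewrite part_weight_cons big_ord_recl wcons0 /= PoszD -IH; congr (_ + _).
by apply: eq_bigr => i _; rewrite wconsS.
Qed.

Lemma KF_odd n s t : odd (sumn (take n s) + sumn (take n t)) -> KF n s t = 0.
Proof.
move=> st_odd; rewrite /KF KostkaFoulkesE altsum_odd // !sum_weightD !sum_part_weight.
move: st_odd; set x := \sum_i _; lia.
Qed.

Lemma part_rho_gt0 n s i : 0 < (part_weight n s + rho n) 0 i.
Proof. by rewrite !mxE; have := ltn_ord i; lia. Qed.

(** With every coordinate of [v] below [b], only the trivial coset can leave a nonnegative first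
    coordinate. *)
Lemma altsum_dominated n (a b : int) (v u : weight n) :
    - b < a -> (forall i, - b < v 0 i) -> (forall i, v 0 i < b) ->
  altsum (wcons a v) (wcons b u) = firstsum (wcons a v) (wcons b u).
Proof.
move=> ab bv vb; rewrite altsum_firstsum => [|i]; last first.
  by rewrite wcons0; case: (unliftP ord0 i) => [j|] ->; rewrite ?wconsS ?wcons0.
rewrite (bigD1 ord0) //= big1 => [|j j0].
  rewrite mul1r addr0; congr firstsum.
  by apply/rowP=> i; rewrite act_tpermE tperm1 perm1.
rewrite firstsum_lt0 ?mulr0 // act_tpermE tpermL wcons0.
by case: (unliftP ord0 j) j0 => [i|] ->; rewrite ?eqxx // wconsS.
Qed.

(* The bound on s makes every later entry of lambda + rho smaller than the first
   entry of mu + rho, so that only lambda_1 can be moved to the first place. *)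
Lemma KF_head n a s b t : all (leq^~ b) s ->
  KF n.+1 (a :: s) (b :: t) =
  firstsum (wcons (a%:Z + n.+1%:Z) (part_weight n s + rho n))
           (wcons (b%:Z + n.+1%:Z) (part_weight n t + rho n)).
Proof.
move=> sb; rewrite /KF KostkaFoulkesE !part_weight_cons !rhoS !wconsD.
apply: altsum_dominated => [|i|i]; first lia.
  by apply: lt_trans (part_rho_gt0 _ _); lia.
rewrite !mxE; have : (nth 0%N s i <= b)%N.
  have [lis|sil] := ltnP i (size s); first exact: (all_nthP 0%N sb).
  by rewrite nth_default.
by have := ltn_ord i; lia.
Qed.

Lemma KF_eq_head n s b t : all (leq^~ b) s -> KF n.+1 (b :: s) (b :: t) = KF n s t.
Proof. by move=> sb; rewrite KF_head // firstsum_eq /KF KostkaFoulkesE. Qed.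

Lemma KF_lt_head n a s b t : all (leq^~ b) s -> (a < b)%N -> KF n.+1 (a :: s) (b :: t) = 0.
Proof. by move=> sb ab; rewrite KF_head // firstsum_lt0 // !wcons0; lia. Qed.

Lemma KF_head1 n s b t : all (leq^~ b) s ->
  KF n.+1 (b.+1 :: s) (b :: t) =
  'X * \sum_l altsum (part_weight n s + rho n + letter l) (part_weight n t + rho n).
Proof. by move=> sb; rewrite KF_head // firstsum_diff1 //; lia. Qed.

Lemma KF_nilr n s : KF n s [::] = KF n s [:: 0%N].
Proof. by rewrite /KF part_weight0. Qed.

Lemma KF_nill n t : KF n [::] t = KF n [:: 0%N] t.
Proof. by rewrite /KF part_weight0. Qed.

Lemma rho_hook n k : rho n.+1 + letter (ord0, false) *+ k = part_weight n.+1 [:: k] + rho n.+1.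
Proof.
rewrite addrC; congr (_ + _); apply/rowP=> i; rewrite mulmxnE letter_coord mxE.
by case: i => -[|i] ilt; rewrite /= ?mul0rn ?nth_nil // natz.
Qed.

Lemma rho_e0 n : rho n.+1 + letter (ord0, false) = part_weight n.+1 [:: 1%N] + rho n.+1.
Proof. by rewrite -rho_hook. Qed.

Lemma rho_e0e0 n :
  rho n.+1 + letter (ord0, false) + letter (ord0, false) = part_weight n.+1 [:: 2%N] + rho n.+1.
Proof. by rewrite -rho_hook mulr2n addrA. Qed.

Lemma hook11E n : hook11 (rho n.+1) = KF n.+1 [:: 1; 1]%N [::].
Proof.
rewrite /hook11; case: n => [|n].
  rewrite KF_odd // big1 // => i; by rewrite ord1.
have lt1 : (1 < n.+2)%N by [].
rewrite (big_pred1 (Ordinal lt1)) => [|i]; last by [].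
rewrite /KF KostkaFoulkesE part_weight_nil add0r; congr altsum.
rewrite rho_e0 addrAC; congr (_ + _); apply/rowP=> i.
rewrite weightD letter_coord !mxE /=.
by case: i => -[|[|i]] ilt; rewrite /= ?addr0 ?nth_nil.
Qed.

(** Dropping the common first coordinate descends to rank 0, where the group is trivial and there
    are no roots. *)
Lemma KF_diag0 n : KF n [::] [::] = 1.
Proof.
elim: n => [|n IH]; last by rewrite KF_nilr KF_nill KF_eq_head.
rewrite /KF KostkaFoulkesE /altsum (big_pred1 (sperm_id 0)) => [|w]; last first.
  apply/esym/eqP; case: w => p s; congr (_, _); last by apply/ffunP=> -[].
  by apply/permP=> -[].
rewrite /sperm_id sperm_odd_perm odd_perm1 mul1r.
apply/polyP=> k; rewrite coef_qpartition_vpart coef1.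
have -> : undup (pos_roots 0) = [::].
  case: (undup _) (mem_undup (pos_roots 0)) => // a s /(_ a).
  by rewrite mem_head => /esym/mem_pos_roots[[[]]|[[]]].
rewrite /vpart (_ : _ == 0); first by rewrite natz.
by apply/eqP/rowP=> -[].
Qed.

Lemma KF_head2 n b t : 
  2 * KF n.+1 [:: b.+2] (b :: t) =
  2 * ('X * KF n [::] t) +
  'X^2 * (\sum_l \sum_l' altsum (rho n + letter l + letter l') (part_weight n t + rho n) +
          \sum_l altsum (rho n + letter l + letter l) (part_weight n t + rho n)).
Proof.
rewrite KF_head // firstsum_diff2; last lia.
by rewrite part_weight_nil add0r /KF KostkaFoulkesE part_weight_nil add0r.
Qed.

Lemma polyint_mul2I (p r : {poly int}) : 2 * p = 2 * r -> p = r.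
Proof.
have two : (2 : {poly int}) != 0 by rewrite -[2]/(2%:R) -polyC_natr polyC_eq0.
exact: (mulfI two).
Qed.

(** The right side is independent of [b]: [b = 0] is the recurrence for (2) over the zero weight,
    and [b = 1] reduces (3) over (1) to it. *)
Lemma KF_head2_nil n b : KF n.+2 [:: b.+2] [:: b] = 'X + 'X^2 * KF n.+1 [:: 2%N] [::].
Proof.
apply: polyint_mul2I; rewrite KF_head2 KF_diag0 part_weight_nil add0r mulr1.
rewrite straighten_sym2 rho_e0e0 /KF KostkaFoulkesE part_weight_nil add0r.
move: (altsum _ _) => A; ring.
Qed.

(** Rank 0 has no letters, so only [2 eps_1] contributes. *)
Lemma KF_2_rank1 : KF 1 [:: 2%N] [::] = 'X.
Proof.
apply: polyint_mul2I; rewrite KF_nilr KF_head2 KF_diag0 mulr1.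
by rewrite !big1 ?addr0 ?mulr0 ?addr0 // => -[[]].
Qed.

Lemma KF_head_vector n b : 
  KF n.+2 [:: b.+2; 1%N] [:: b.+1] =
  'X * (KF n.+1 [:: 2%N] [::] + KF n.+1 [:: 1; 1]%N [::] + 1).
Proof.
rewrite KF_head1 // -rho_e0 part_weight_nil add0r straighten_vector_vector.
rewrite rho_e0e0 hook11E -(KF_diag0 n.+1) /KF !KostkaFoulkesE part_weight_nil.
by rewrite add0r.
Qed.

(** [KF_head] does not apply, because the second entry of [lambda + rho] equals the first entry of
    [mu + rho]. Two cosets survive: the trivial one, with difference 1, gives ['X] times a tensor
    square, and the transposition, with difference 0, gives [- KF n.+1 [:: 2] [::]]. *)
Lemma KF_11_nil n :
  KF n.+2 [:: 1; 1]%N [::] =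
  ('X - 1) * KF n.+1 [:: 2%N] [::] + 'X * KF n.+1 [:: 1; 1]%N [::] + 'X.
Proof.
have -> : KF n.+2 [:: 1; 1]%N [::] =
    altsum (wcons (n.+3%:Z) (part_weight n.+1 [:: 1%N] + rho n.+1))
           (wcons n.+2%:Z (rho n.+1)).
  rewrite /KF KostkaFoulkesE part_weight_nil add0r part_weight_cons [in LHS]rhoS wconsD.
  by rewrite -rhoS; congr (altsum (wcons _ _) _); lia.
rewrite altsum_firstsum => [|i]; last first.
  rewrite wcons0; case: (unliftP ord0 i) => [j|] ->; rewrite ?wcons0 // wconsS.
  by apply: lt_trans (part_rho_gt0 _ _).
rewrite 2!big_ord_recl big1 ?addr0 => [|i _]; last first.
  rewrite firstsum_lt0 ?mulr0 // act_tpermE tpermL wcons0 wconsS !mxE !lift0 /=.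
  by rewrite nth_nil; lia.
rewrite /= mul1r expr1 mulN1r.
have -> : sperm_act (tperm ord0 ord0, [ffun=> false])
    (wcons n.+3%:Z (part_weight n.+1 [:: 1%N] + rho n.+1)) =
    wcons n.+3%:Z (part_weight n.+1 [:: 1%N] + rho n.+1).
  by apply/rowP=> i; rewrite act_tpermE tperm1 perm1.
(* The swap moves [n + 3 = 2 + (n + 1)] to the head of the remaining coordinates, which therefore
   form (2) plus [rho]. *)
have -> : sperm_act (tperm ord0 (lift ord0 ord0), [ffun=> false])
    (wcons n.+3%:Z (part_weight n.+1 [:: 1%N] + rho n.+1)) =
    wcons n.+2%:Z (part_weight n.+1 [:: 2%N] + rho n.+1).
  apply: eq_weightS => [|i]; rewrite act_tpermE.
    by rewrite tpermL wcons0 wconsS !mxE /=; lia.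
  case: (unliftP ord0 i) => [j|] ->; last first.
    by rewrite tpermR wcons0 wconsS !mxE /=; lia.
  by rewrite tpermD // !wconsS !mxE !lift0.
rewrite firstsum_eq firstsum_diff1; last lia.
rewrite -rho_e0 straighten_vector_vector hook11E rho_e0e0.
have -> : altsum (rho n.+1) (rho n.+1) = 1.
  by rewrite -(KF_diag0 n.+1) /KF KostkaFoulkesE part_weight_nil add0r.
rewrite [KF n.+1 [:: 2%N] _]/KF KostkaFoulkesE part_weight_nil add0r.
move: (altsum _ _) (KF _ _ _) => A B; ring.
Qed.

(** * Closed forms with cleared denominators *)

Lemma KF_2_nil n :
  KF n.+1 [:: 2%N] [::] * ('X^2 - 1) = 'X * ('X^(2 * n.+1) - 1).
Proof.
elim: n => [|n IH]; first by rewrite KF_2_rank1 muln1.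
rewrite KF_nilr KF_head2_nil mulrDl -mulrA IH (mulnS 2 n.+1) exprD.
by move: 'X^(2 * n.+1) => Y; ring.
Qed.

Lemma KF_11_nil_closed n :
  KF n.+1 [:: 1; 1]%N [::] * ('X^2 - 1) = 'X^2 * ('X^(2 * n) - 1).
Proof.
(* In rank 1 the second part is truncated, so the weight has odd size. *)
elim: n => [|n IH]; first by rewrite KF_odd // mul0r muln0 subrr mulr0.
rewrite KF_11_nil !mulrDl -!mulrA IH KF_2_nil (mulnS 2 n) exprD.
by move: 'X^(2 * n) => Y; ring.
Qed.

Lemma KF_21_1 n :
  KF n.+2 [:: 2; 1]%N [:: 1%N] * ('X - 1) = 'X * ('X^(2 * n.+1) - 1).
Proof.
(* The factor ['X + 1] turns ['X - 1] into ['X^2 - 1], the denominator of both closed forms used. *)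
have X1 : 'X + 1 != 0 :> {poly int} by rewrite -size_poly_eq0 size_XaddC.
apply: (mulfI X1); rewrite KF_head_vector.
have := KF_2_nil n; have := KF_11_nil_closed n; rewrite (mulnS 2 n) exprD.
move: (KF _ _ _) (KF _ _ _) ('X^(2 * n)) => A B Y eB eA.
have -> : ('X + 1) * ('X * (A + B + 1) * ('X - 1)) =
  'X * (A * ('X^2 - 1) + B * ('X^2 - 1) + ('X^2 - 1)) by ring.
by rewrite eA eB; ring.
Qed.

(** Stripping the first coordinate leaves the vector representation, whose multiplicity polynomial
    at (1) is 1. *)
Lemma KF_2_11 n : KF n.+3 [:: 2%N] [:: 1; 1]%N = 'X.
Proof.
rewrite KF_head1 // part_weight_nil add0r straighten_vector rho_e0.
have := KF_eq_head n.+1 (s := [::]) (b := 1%N) [::] isT.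
by rewrite KF_diag0 /KF KostkaFoulkesE => ->; rewrite mulr1.
Qed.

Theorem mainTheorem7 (n : nat) (hn : (3 <= n)%N)
    (q := ('X : {poly int})%:F : {fraction {poly int}}) :
  [/\ KF n [:: 3]%N [:: 2]%N = 0, KF n [:: 3]%N [:: 1; 1]%N = 0,
      KF n [:: 3]%N [::] = 0
    & (KF n [:: 3]%N [:: 1]%N)%:F = q * ((q ^+ (2 * n) - 1) / (q ^+ 2 - 1))] /\
  [/\ KF n [:: 2; 1]%N [:: 2]%N = 0, KF n [:: 2; 1]%N [:: 1; 1]%N = 0,
      KF n [:: 2; 1]%N [::] = 0
    & (KF n [:: 2; 1]%N [:: 1]%N)%:F = q * ((q ^+ (2 * n - 2) - 1) / (q - 1))] /\
  [/\ KF n [:: 1; 1; 1]%N [:: 2]%N = 0, KF n [:: 1; 1; 1]%N [:: 1; 1]%N = 0,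
      KF n [:: 1; 1; 1]%N [::] = 0
    & (KF n [:: 1; 1; 1]%N [:: 1]%N)%:F
      = q ^+ 2 * ((q ^+ (2 * n - 4) - 1) / (q ^+ 2 - 1))] /\
  [/\ KF n [:: 2]%N [:: 2]%N = 1, KF n [:: 2]%N [:: 1; 1]%N = 'X,
      KF n [:: 2]%N [:: 1]%N = 0
    & (KF n [:: 2]%N [::])%:F = q * ((q ^+ (2 * n) - 1) / (q ^+ 2 - 1))] /\
  [/\ KF n [:: 1; 1]%N [:: 2]%N = 0, KF n [:: 1; 1]%N [:: 1; 1]%N = 1,
      KF n [:: 1; 1]%N [:: 1]%N = 0
    & (KF n [:: 1; 1]%N [::])%:F
      = q ^+ 2 * ((q ^+ (2 * n - 2) - 1) / (q ^+ 2 - 1))].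
Proof.
have X1 : 'X - 1 != 0 :> {poly int} by rewrite -size_poly_eq0 size_XsubC.
have X2 : 'X^2 - 1 != 0 :> {poly int} by rewrite -size_poly_eq0 size_XnsubC.
have qX k : q ^+ k - 1 = ('X^k - 1 : {poly int})%:F.
  by rewrite tofracB tofracXn tofrac1.
have closed (p r s : {poly int}) : s != 0 -> p * s = r -> p%:F = r%:F / s%:F.
  by move=> s0 <-; rewrite tofracM mulfK // tofrac_eq0.
(* Writing [q - 1] as [q ^+ 1 - 1] lets [qX] cover all numerators and denominators. *)
rewrite -[in q - 1](expr1 q) !qX expr1 /q -tofracXn !mulrA -!tofracM.
case: n hn => [|[|[|n]]] // _.
have e2 : (2 * n.+3 - 2 = 2 * n.+2)%N by lia.
have e4 : (2 * n.+3 - 4 = 2 * n.+1)%N by lia.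
(* All zero entries vanish by parity except (1,1) over (2), whose first part is too small. *)
rewrite {}e2 {}e4; do ![split]; try by [exact: KF_odd | exact: KF_lt_head].
- apply: closed => //; rewrite KF_head2_nil mulrDl -mulrA KF_2_nil (mulnS 2 n.+2) exprD.
  by move: 'X^(2 * n.+2) => Y; ring.
- by apply: closed => //; rewrite KF_21_1.
- by apply: closed => //; rewrite KF_eq_head // KF_11_nil_closed.
- by rewrite KF_eq_head // KF_diag0.
- exact: KF_2_11.
- by apply: closed => //; rewrite KF_2_nil.
- by rewrite KF_eq_head // KF_eq_head // KF_diag0.
- by apply: closed => //; rewrite KF_11_nil_closed.
Qed.
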